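(* Let $A$ be a C*-subalgebra of a C*-algebra $B$ and let $P\colon B\to A$ be a conditional expectation. For every ideal $I$ of $A$ and every ideal $J$ of $B$, $$J\subseteq \mathrm{Ind}_P(I)\quad\text{if and only if}\quad \mathrm{Coind}_P(J)\subseteq I.$$
   Context: ''Ideal'' means closed two-sided ideal; C*-algebras are not assumed unital. A conditional expectation $P\colon B\to A$ is a contractive (completely) positive $A$-bimodule projection of $B$ onto $A$. For an ideal $I$ of $A$, $\mathrm{Ind}_P(I)=\{b\in B: P(xby)\in I\text{ for all }x,y\in B\}$, an ideal of $B$. For an ideal $J$ of $B$, $\mathrm{Coind}_P(J)=\overline{P(J)}$ (norm closure), an ideal of $A$. *)

(* Defs.v *)
From HB Require Import structures.
From mathcomp Require Import all_boot all_order all_algebra.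
From mathcomp Require Import complex.
From mathcomp Require Import all_classical all_reals all_analysis.

Set Implicit Arguments.
Unset Strict Implicit.
Unset Printing Implicit Defensive.

Import Order.TTheory GRing.Theory Num.Theory.
Import numFieldNormedType.Exports.

Local Open Scope classical_set_scope.
Local Open Scope ring_scope.
Local Open Scope complex_scope.

(* MathComp rings are unital, whereas C*-algebras here need not be; the product
   is therefore that of [semigroupType], written [(x * y)%g].  The norm of a
   normed module over [R[i]] is [R[i]]-valued, with nonnegative real values. *)
HB.mixin Record isCstarAlgebra (R : realType) B
    of CompleteNormedModule R[i] B & Semigroup B := {
  star : B -> B ;
  cstar_mulDl : forall x y z : B, ((x + y)%R * z)%g = (x * z)%g + (y * z)%g ;
  cstar_mulDr : forall x y z : B, (x * (y + z)%R)%g = (x * y)%g + (x * z)%g ;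
  cstar_scaleAl : forall (c : R[i]) (x y : B), ((c *: x) * y)%g = c *: (x * y)%g ;
  cstar_scaleAr : forall (c : R[i]) (x y : B), (x * (c *: y))%g = c *: (x * y)%g ;
  starK : involutive star ;
  starD : forall x y : B, star (x + y) = star x + star y ;
  starZ : forall (c : R[i]) (x : B), star (c *: x) = c^* *: star x ;
  starM : forall x y : B, star (x * y)%g = (star y * star x)%g ;
  cstar_norm_mul : forall x y : B, `|(x * y)%g| <= `|x| * `|y| ;
  cstar_identity : forall x : B, `|(star x * x)%g| = `|x| ^+ 2
}.

#[short(type="cstarAlgType")]
HB.structure Definition CstarAlgebra (R : realType) :=
  { B of isCstarAlgebra R B & CompleteNormedModule R[i] B & Semigroup B }.

Section Definitions.
Context {R : realType} {B : cstarAlgType R}.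
Implicit Types (A I J : set B).

Record is_closed_subspace A : Prop := {
  subspace0 : A 0 ;
  subspaceD : forall x y, A x -> A y -> A (x + y) ;
  subspaceZ : forall (c : R[i]) x, A x -> A (c *: x) ;
  subspace_closed : closed A
}.

Record is_cstar_subalgebra A : Prop := {
  subalgebra_subspace : is_closed_subspace A ;
  subalgebraM : forall x y, A x -> A y -> A (x * y)%g ;
  subalgebra_star : forall x, A x -> A (star x)
}.

(* [is_ideal A I]: I is a closed two-sided ideal of the C*-subalgebra A; ideals
   of the whole algebra are the case [A = setT].  As A is closed in B, closed
   in A and closed in B mean the same for subsets of A. *)
Record is_ideal A I : Prop := {
  ideal_sub : I `<=` A ;
  ideal_subspace : is_closed_subspace I ;
  ideal_mull : forall a x, A a -> I x -> I (a * x)%g ;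
  ideal_mulr : forall a x, A a -> I x -> I (x * a)%g
}.

Definition positive_in A : set B :=
  [set x | exists2 y, A y & x = (star y * y)%g].

(* A map B -> A is represented by a map B -> B with values in A.  Only
   positivity is required: complete positivity implies it, and is automatic
   for contractive projections onto A by Tomiyama's theorem. *)
Record is_conditional_expectation A (P : {linear B -> B}) : Prop := {
  condexp_range : forall b, A (P b) ;
  condexp_id : forall a, A a -> P a = a ;
  condexp_contractive : forall b, `|P b| <= `|b| ;
  condexp_positive : forall b, positive_in setT b -> positive_in A (P b) ;
  condexp_mull : forall a b, A a -> P (a * b)%g = (a * P b)%g ;
  condexp_mulr : forall a b, A a -> P (b * a)%g = (P b * a)%g
}.

Definition Ind (P : B -> B) I : set B :=
  [set b | forall x y, I (P (x * b * y)%g)].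

Definition Coind (P : B -> B) J : set B := closure (P @` J).

End Definitions.

(* Main.v *)
Require Import Defs.
From mathcomp Require Import all_boot all_order all_algebra.
From mathcomp Require Import all_classical all_reals all_analysis.
From mathcomp Require Import complex ring.
Import numFieldNormedType.Exports Order.TTheory GRing.Theory Num.Theory.

(** One implication is formal: if j lies in J, then so does x j y, and P (x j y)
    lies in P(J).  For the other one, suppose that P (x j y) lies in I for all
    x, y in B and all j in J.  If B had a unit, x = y = 1 would give P j in I.
    In general it suffices that j be a limit of elements x j y
    ([exists_two_sided_mul_near]): P is contractive and I is closed, so P j
    lies in I, and then so does the closure of P(J).

    The approximation is usually obtained from an approximate unit, built with
    the functional calculus.  Here it comes from resolvents of self-adjoint
    elements alone.  For self-adjoint r and any z, the C*-identity gives
    |z + i r z|^2 = |z* z + (r z)* (r z)| = |z - i r z|^2, so that both |z| and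
    |r z| are at most |z + i r z|.  The same identity with other coefficients
    turns the equation z + i r z = w into a fixed point problem for a
    contraction ([selfadjoint_shift_surj]).  Taking r to be a large multiple
    s j* j, the solution y for w = j* has norm at most s^(-1/2), and the adjoint
    of the equation exhibits j - y* as a left multiple of j
    ([exists_left_mul_near]).  The same for j* gives the right-hand side. *)

Local Open Scope classical_set_scope.

(** * Contractions of complex Banach spaces *)

Section FixedPoint.
Set Implicit Arguments.
Unset Strict Implicit.
Unset Printing Implicit Defensive.
Local Open Scope ring_scope.
Variable R : realType.
Local Notation C := R[i].

(** The order of R[i] compares only numbers with equal imaginary parts, so the
    statement is the one over R, transported along the embedding of R. *)
Lemma near_expr_lt (q e : C) : 0 <= q -> q < 1 -> 0 < e ->
  \forall n \near \oo, q ^+ n < e.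
Proof.
move=> q0 q1 e0.
have toR (x : C) : 0 <= x -> exists2 r : R, 0 <= r & x = (r%:C)%C.
  case: x => a b; rewrite lecE /= => /andP[/eqP -> a0]; by exists a.
have [r r0 qE] := toR _ q0; have [t t0 eE] := toR _ (ltW e0); subst q e.
have {q1} r1 : `|r| < 1 by rewrite ger0_norm // -ltcR.
have {e0} {}t0 : 0 < t by rewrite -ltcR.
have /cvgrPdist_lt/(_ t t0) := cvg_expr r1.
apply: filterS => n; rewrite sub0r normrN ger0_norm ?exprn_ge0 // => h.
by rewrite -rmorphXn ltcR.
Qed.

(** Banach's fixed point theorem over complex scalars.  The inequality [defect]
    makes the distance of two points small as soon as both are nearly fixed;
    the iterates of f become nearly fixed geometrically fast, hence they form a
    Cauchy sequence, and the same estimate carries over to the limit. *)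
Lemma contraction_has_fixpoint (X : completeNormedModType C) (f : X -> X)
    (q : C) : 0 <= q -> q < 1 ->
  (forall x y, `|f x - f y| <= q * `|x - y|) -> exists p, p = f p.
Proof.
move=> q0 q1 fq.
have q1' : 0 < 1 - q by rewrite subr_gt0.
have defect x y : (1 - q) * `|x - y| <= `|f x - x| + `|f y - y|.
  rewrite mulrBl mul1r lerBlDr.
  have {1}-> : x - y = - (f x - x) + ((f x - f y) + (f y - y)).
    by rewrite opprB !addrA !subrK.
  apply: le_trans (ler_normD _ _) _; rewrite normrN -[leRHS]addrA lerD2l.
  by apply: le_trans (ler_normD _ _) _; rewrite [leRHS]addrC lerD2r fq.
pose u n := iter n f 0.
have uE n : `|f (u n) - u n| <= q ^+ n * `|f 0 - 0|.
  elim: n => [|n ih]; first by rewrite expr0 mul1r.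
  rewrite exprS -mulrA.
  by apply: le_trans (fq (u n.+1) (u n)) _; rewrite ler_wpM2l.
have small e : 0 < e -> \forall n \near \oo, `|f (u n) - u n| < e.
  move=> e0; set d := `|f 0 - 0| in uE.
  have d1 : 0 < d + 1 by rewrite ltr_wpDl ?normr_ge0.
  have := near_expr_lt q0 q1 (divr_gt0 e0 d1); apply: filterS => n.
  rewrite ltr_pdivlMr // => h; apply: le_lt_trans (uE n) (le_lt_trans _ h).
  by rewrite ler_wpM2l ?exprn_ge0 // lerDl.
have /cauchy_cvg/cvg_ex[p up] : cauchy (u @ \oo).
  apply: cauchy_exP => e e0.
  have e1 : 0 < (1 - q) * e / 2 by rewrite divr_gt0 // mulr_gt0.
  have [N _ HN] := small _ e1; exists (u N); exists N => // n Nn /=.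
  rewrite -ball_normE /=; rewrite -(ltr_pM2l q1').
  apply: le_lt_trans (defect _ _) _; rewrite [ltRHS]splitr.
  by apply: ltrD; apply: HN => //=.
exists p; apply/eqP; rewrite -subr_eq0 -normr_le0; apply/ler_addgt0Pr => e e0.
rewrite add0r; have e3 : 0 < e / 3 by rewrite divr_gt0.
have [n [un /= pn]] : exists n, `|f (u n) - u n| < e / 3 /\ `|p - u n| < e / 3.
  have /cvgrPdist_lt/(_ _ e3) up' := up.
  by have [n ?] := filter_ex (filterI (small _ e3) up'); exists n.
have -> : p - f p = (p - u n) + (- (f (u n) - u n) + (f (u n) - f p)).
  by rewrite opprB !addrA !subrK.
have -> : e = e / 3 + (e / 3 + e / 3) by field.
apply: le_trans (ler_normD _ _) _; apply: lerD; first exact: ltW.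
apply: le_trans (ler_normD _ _) _; rewrite normrN.
apply: lerD; first exact: ltW.
apply: le_trans (fq _ _) _; rewrite distrC.
apply: le_trans (ltW pn); exact: ler_piMl (ltW q1).
Qed.

End FixedPoint.

(** * Resolvents of self-adjoint elements *)

Section Resolvents.
Set Implicit Arguments.
Unset Strict Implicit.
Unset Printing Implicit Defensive.
Local Open Scope ring_scope.
Variables (R : realType) (B : cstarAlgType R).
Local Notation C := R[i].
Implicit Types (x y z w r h g j : B) (a b c s e : C).

Lemma cstar_mulNr x y : (x * - y)%g = - (x * y)%g.
Proof. by rewrite -scaleN1r cstar_scaleAr scaleN1r. Qed.

Lemma cstar_mulNl x y : (- x * y)%g = - (x * y)%g.
Proof. by rewrite -scaleN1r cstar_scaleAl scaleN1r. Qed.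

Lemma star_scale c x : star (c *: x) = c^* *: star x.
Proof. exact: starZ. Qed.

Lemma starN x : star (- x) = - star x.
Proof. by rewrite -scaleN1r star_scale rmorphN /= conjC1 scaleN1r. Qed.

(** The C*-identity gives |y|^2 = |y* y| <= |y*| |y|, applied to
    y = x and to y = x*. *)
Lemma norm_star x : `|star x| = `|x|.
Proof.
suff le_star y : `|y| <= `|star y|.
  by apply/eqP; rewrite eq_le le_star -{2}[x]starK le_star.
have [->|y0] := eqVneq y 0; first by rewrite normr0.
rewrite -(ler_pM2r (_ : 0 < `|y|)) ?normr_gt0 // -expr2 -cstar_identity.
exact: cstar_norm_mul.
Qed.

(** For real a, b and self-adjoint r, the cross terms of (a - i b r)(a + i b r)
    cancel.  The estimates on 1 + i r that would follow from the reality of the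
    spectrum of r are all drawn from this identity. *)
Lemma norm_sq_selfadjoint_shift r z a b :
  star r = r -> a^* = a -> b^* = b ->
  `|a *: z + ('i * b) *: (r * z)%g| ^+ 2 =
  `|a ^+ 2 *: (star z * z)%g + b ^+ 2 *: (star (r * z) * (r * z))%g|.
Proof.
move=> rs ar br; rewrite -cstar_identity starD !star_scale starM rs.
rewrite rmorphM /= ar br conjCi cstar_mulDl !cstar_mulDr.
rewrite !(cstar_scaleAl, cstar_scaleAr) !scalerA !mulgA -!expr2.
have -> : - 'i * b * a = - (a * ('i * b)) :> C by ring.
have -> : - 'i * b * ('i * b) = b ^+ 2.
  by transitivity (- ('i ^+ 2) * b ^+ 2); [ring | rewrite sqrCi; ring].
by rewrite scaleNr addrA addrK.
Qed.

(** The right-hand side of the previous identity is even in b. *)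
Lemma norm_selfadjoint_shift_conj r z : star r = r ->
  `|z + 'i *: (r * z)%g| = `|z - 'i *: (r * z)%g|.
Proof.
move=> rs; apply/eqP; rewrite -(eqrXn2 (n := 2)) //; apply/eqP.
have N1 : (- 1)^* = - 1 :> C by rewrite rmorphN /= conjC1.
have := norm_sq_selfadjoint_shift z rs (conjC1 _) N1.
have := norm_sq_selfadjoint_shift z rs (conjC1 _) (conjC1 _).
by rewrite sqrrN mulrN mulr1 scaleNr scale1r => -> ->.
Qed.

(** 1 + i r is bounded below by 1, because 2 z is the sum of (1 + i r) z and
    (1 - i r) z, which have the same norm. *)
Lemma norm_le_selfadjoint_shift r z : star r = r ->
  `|z| <= `|z + 'i *: (r * z)%g|.
Proof.
move=> rs; rewrite -(ler_pM2l (_ : 0 < 2 :> C)) //.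
have -> : 2 * `|z| = `|(z + 'i *: (r * z)%g) + (z - 'i *: (r * z)%g)|.
  by rewrite addrACA subrr addr0 -mulr2n normrMn mulr_natl.
apply: le_trans (ler_normD _ _) _.
by rewrite -(norm_selfadjoint_shift_conj z rs) -mulr2n mulr_natl.
Qed.

(** Likewise 2 i r z is the difference of (1 + i r) z and (1 - i r) z. *)
Lemma norm_mul_le_selfadjoint_shift r z : star r = r ->
  `|(r * z)%g| <= `|z + 'i *: (r * z)%g|.
Proof.
move=> rs; rewrite -(ler_pM2l (_ : 0 < 2 :> C)) //.
have -> : 2 * `|(r * z)%g| = `|(z + 'i *: (r * z)%g) - (z - 'i *: (r * z)%g)|.
  by rewrite opprB addrC addrA subrK -mulr2n normrMn normrZ normCi mul1r
    mulr_natl.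
apply: le_trans (ler_normB _ _) _.
by rewrite -(norm_selfadjoint_shift_conj z rs) -mulr2n mulr_natl.
Qed.

(** To solve (1 + i r) y = w, iterate y |-> y - l ((1 + i r) y - w) with a small
    real step l.  Its linear part (1 - l) - i l r has, by
    [norm_sq_selfadjoint_shift], squared norm at most (1 - l)^2 + l^2 |r|^2;
    this is smallest for l = 1 / (1 + |r|^2), where it equals 1 - l. *)
Lemma selfadjoint_shift_surj r w : star r = r ->
  exists y, y + 'i *: (r * y)%g = w.
Proof.
move=> rs; set M := `|r| ^+ 2; have M0 : 0 <= M by rewrite exprn_ge0.
have M1 : 0 < 1 + M by rewrite ltr_pwDl.
have M1n : 1 + M != 0 by rewrite gt_eqF.
pose l := (1 + M)^-1; have l0 : 0 < l by rewrite invr_gt0.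
pose T y := y + 'i *: (r * y)%g.
pose f y := y - l *: (T y - w).
suff [p fp] : exists p, p = f p.
  have /eqP : l *: (T p - w) = 0.
    by apply: (addrI (f p)); rewrite addr0 -[RHS]fp subrK.
  by rewrite scaler_eq0 gt_eqF //= subr_eq0 => /eqP; exists p.
have q1 : 1 - l < 1 by rewrite gtrBl.
have q0 : 0 <= 1 - l by rewrite subr_ge0 invf_le1 // lerDl.
apply: (@contraction_has_fixpoint _ _ f (sqrtC (1 - l))).
- by rewrite sqrtC_ge0.
- by rewrite -[ltRHS]sqrtC1 ltr_sqrtC ?nnegrE.
move=> x y; set z := x - y.
have lr c : 0 <= c -> c^* = c by move=> c0; rewrite geC0_conj.
have -> : f x - f y = (1 - l) *: z + ('i * - l) *: (r * z)%g.
  transitivity (z - l *: (z + 'i *: (r * z)%g)).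
    have -> : z + 'i *: (r * z)%g = (T x - w) - (T y - w).
      rewrite opprB addrA subrK /T /z cstar_mulDr cstar_mulNr scalerBr.
      by rewrite opprD addrACA.
    by rewrite /f opprD addrACA -opprD -scalerBr.
  rewrite scalerDr opprD addrA scalerA mulrN ['i * l]mulrC scaleNr.
  by rewrite scalerBl scale1r.
rewrite -(ler_pXn2r (n := 2)) // ?nnegrE ?mulr_ge0 ?sqrtC_ge0 //.
rewrite exprMn sqrtCK norm_sq_selfadjoint_shift //; last 2 first.
- exact: lr.
- by rewrite rmorphN /= lr // ltW.
apply: le_trans (ler_normD _ _) _; rewrite !normrZ !cstar_identity.
rewrite -![`|_| * `|_|]expr2 normrN (ger0_norm q0) (gtr0_norm l0).
apply: (@le_trans _ _ ((1 - l) ^+ 2 * `|z| ^+ 2 + l ^+ 2 * (M * `|z| ^+ 2))).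
  rewrite lerD2l ler_wpM2l ?exprn_ge0 ?(ltW l0) // -exprMn.
  by rewrite ler_pXn2r ?nnegrE ?mulr_ge0 // cstar_norm_mul.
have {2}-> : 1 - l = (1 - l) ^+ 2 + l ^+ 2 * M by rewrite /l; field.
by rewrite mulrDl [l ^+ 2 * (_ * _)]mulrA.
Qed.

(** The equation says that g is h / (1 + i s h), which is at most 1 / s in
    absolute value for real h.  To see it without spectral theory, solve
    (1 - i s h) v = g; moving 1 - i s h across the product as an adjoint,
    |g|^2 = |g* (1 - i s h) v| = |((1 + i s h) g)* v| = |h v|, and
    s |h v| <= |g| by [norm_mul_le_selfadjoint_shift]. *)
Lemma norm_selfadjoint_resolvent_le h g s : star h = h -> 0 < s ->
  g + 'i *: (s *: h * g)%g = h -> s * `|g| <= 1.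
Proof.
move=> hs s0 gE; have sr : s^* = s by rewrite geC0_conj // ltW.
have rs : star (s *: h) = s *: h by rewrite star_scale sr hs.
have rNs : star (- (s *: h)) = - (s *: h).
  by rewrite -scaleNr star_scale rmorphN /= sr hs.
have [v vE] := selfadjoint_shift_surj g rNs.
have [->|g0] := eqVneq g 0; first by rewrite normr0 mulr0.
rewrite -(ler_pM2r (_ : 0 < `|g|)) ?normr_gt0 // mul1r -mulrA -expr2.
have gg : (star g * g)%g = (h * v)%g.
  transitivity (star (g + 'i *: (s *: h * g)%g) * v)%g; last by rewrite gE hs.
  transitivity (star g * (v + 'i *: (- (s *: h) * v)%g))%g.
    by rewrite vE.
  rewrite starD star_scale starM rs conjCi cstar_mulDl cstar_mulDr.
  by rewrite !(cstar_mulNl, cstar_mulNr, scalerN, scaleNr, cstar_scaleAl,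
               cstar_scaleAr, mulgA).
rewrite -cstar_identity gg -vE.
apply: le_trans (norm_mul_le_selfadjoint_shift v rNs).
by rewrite cstar_mulNl normrN cstar_scaleAl normrZ gtr0_norm.
Qed.

End Resolvents.

(** * Approximate units *)

Section ApproximateUnits.
Set Implicit Arguments.
Unset Strict Implicit.
Unset Printing Implicit Defensive.
Local Open Scope ring_scope.
Variables (R : realType) (B : cstarAlgType R).
Local Notation C := R[i].
Implicit Types (x y j : B) (e s : C).

(** With h = j* j and s > 0, let y solve (1 + i s h) y = j*.  Taking adjoints,
    j = y* - i s y* j* j, so j differs from a left multiple of itself by y*.
    That error is small: |y|^2 = |y y*| <= |(1 + i s h) y y*| = |j* y*| = |y j|,
    and y j = h / (1 + i s h) has norm at most 1 / s. *)
Lemma exists_left_mul_near j e : 0 < e -> exists x, `|j - (x * j)%g| <= e.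
Proof.
move=> e0.
(* The error satisfies |y|^2 <= 1 / s, to be compared with e^2. *)
pose s := e ^- 2; have s0 : 0 < s by rewrite invr_gt0 exprn_gt0.
pose h := (star j * j)%g; have hs : star h = h by rewrite starM starK.
have sr : s^* = s by rewrite geC0_conj // ltW.
have rs : star (s *: h) = s *: h by rewrite star_scale sr hs.
have [y yE] := selfadjoint_shift_surj (star j) rs.
pose x := - ('i * s) *: (star y * star j)%g; exists x.
have -> : j - (x * j)%g = star y.
  have jE : j = star y - ('i * s) *: (star y * h)%g.
    rewrite -[LHS]starK -yE starD star_scale starM rs conjCi.
    by rewrite cstar_scaleAr scalerA mulNr scaleNr.
  by rewrite {1}jE /x cstar_scaleAl scaleNr opprK -mulgA subrK.
pose g := (y * j)%g.
have gE : g + 'i *: (s *: h * g)%g = h.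
  by rewrite /g mulgA -cstar_scaleAl -cstar_mulDl yE.
have g_le : s * `|g| <= 1 by exact: norm_selfadjoint_resolvent_le gE.
rewrite norm_star -(ler_pXn2r (n := 2)) // ?nnegrE ?(ltW e0) //.
apply: (@le_trans _ _ `|g|); last first.
  by rewrite -(ler_pM2l s0) mulVf // expf_neq0 // gt_eqF.
rewrite -[`|y|]norm_star -cstar_identity starK.
apply: le_trans (norm_le_selfadjoint_shift _ rs) _.
by rewrite mulgA -cstar_scaleAl -cstar_mulDl yE -starM norm_star.
Qed.

(** Approximate j by x j, then j* by a left multiple of j*, which is the adjoint
    of a right multiple j y; the second precision depends on |x|. *)
Lemma exists_two_sided_mul_near j e : 0 < e ->
  exists x y, `|j - (x * j * y)%g| <= e.
Proof.
move=> e0; have e20 : 0 < e / 2 by rewrite divr_gt0.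
have [x xE] := exists_left_mul_near j e20.
have x1 : 0 < `|x| + 1 by rewrite ltr_wpDl.
have [y yE] := exists_left_mul_near (star j) (divr_gt0 e20 x1).
have jy : `|j - (j * star y)%g| <= e / 2 / (`|x| + 1).
  by rewrite -norm_star starD starN starM starK.
exists x, (star y).
have -> : j - (x * j * star y)%g =
    (j - (x * j)%g) + (x * (j - (j * star y)%g)%R)%g.
  by rewrite cstar_mulDr cstar_mulNr mulgA addrA subrK.
apply: le_trans (ler_normD _ _) _; rewrite [leRHS]splitr; apply: lerD => //.
apply: le_trans (cstar_norm_mul _ _) _.
apply: le_trans (ler_wpM2l (normr_ge0 x) jy) _.
rewrite mulrCA -[leRHS]mulr1 ler_wpM2l ?(ltW e20) //.
by rewrite ler_pdivrMr // mul1r lerDl.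
Qed.

End ApproximateUnits.

(** * The adjunction *)

Theorem proposition2p8 (R : realType) (B : cstarAlgType R) (A : set B)
    (hA : is_cstar_subalgebra A) (P : {linear B -> B})
    (hP : is_conditional_expectation A P)
    (I : set B) (hI : is_ideal A I) (J : set B) (hJ : is_ideal setT J) :
  (J `<=` Ind P I) <-> (Coind P J `<=` I).
Proof.
have Icl : closed I := subspace_closed (ideal_subspace hI).
split=> [JI | PJI j Jj x y]; last first.
  apply: PJI; apply: subset_closure; exists (x * j * y)%g => //.
  by apply: (ideal_mulr hJ) => //; apply: (ideal_mull hJ).
rewrite /Coind closureE; apply: smallest_sub => // _ [j Jj <-].
rewrite (closure_id I).1 // => U /nbhs_ballP[e /= e0 eU].
have [x [y xyE]] := exists_two_sided_mul_near j (divr_gt0 e0 (ltr0Sn _ 1)).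
exists (P (x * j * y)%g); split; first exact: (JI _ Jj).
apply: eU; rewrite -ball_normE /= -linearB.
apply: le_lt_trans (condexp_contractive hP _) (le_lt_trans xyE _).
by rewrite ltr_pdivrMr // ltr_pMr // ltr1n.
Qed.
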